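(* Let $(W,\mathcal S)$ be a finite Coxeter system, $\mathsf c$ a Coxeter word and $m\ge 1$. Let $\mathsf w$ and $\mathsf w'$ be two $m$-factorizations of $\mathsf c$. Let $M=(m+1)|\mathcal R|$ and let $r_0,\dots,r_{M-1}$ be the colored reflections in the order of the letters of $\mathsf R(\mathsf c)^{m+1}$. Define $\mathsf w_0=\mathsf w,\mathsf w_1,\dots,\mathsf w_M$ recursively by: (a) $\mathsf w_{j+1}=\mathsf w_j$ if $r_j\notin\mathsf w_j\setminus\mathsf w'$ and $r_j\notin\mathsf w'\setminus\mathsf w_j$; (b) $\mathsf w_{j+1}$ is the increasing rotation of $\mathsf w_j$ at $r_j$ if $r_j\in\mathsf w_j\setminus\mathsf w'$ and $r_j$ is not of color $m$; (c) otherwise $\mathsf w_{j+1}$ is undefined and the computation aborts. If a $\mathsf c$-increasing chain from $\mathsf w$ to $\mathsf w'$ exists, then the computation does not abort, $\mathsf w_M=\mathsf w'$, and $\mathsf w_0,\dots,\mathsf w_M$ with repetitions removed is the $\mathsf c$-increasing chain from $\mathsf w$ to $\mathsf w'$. If no such chain exists, then the computation aborts.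
   Context: Let $\mathcal R$ be the set of reflections (conjugates of elements of $\mathcal S$), $w_\circ$ the longest element of $W$. A Coxeter word $\mathsf c$ is a word in which each element of $\mathcal S$ appears exactly once; $c\in W$ is its product. Reflection order. The $\mathsf c$-sorting word of $w\in W$ is the leftmost subword of $\mathsf c^\infty=\mathsf c\mathsf c\mathsf c\cdots$ that is a reduced word of $w$. Write the $\mathsf c$-sorting word of $w_\circ$ as $\mathsf s_1\cdots\mathsf s_N$ and put $t_i=s_1\cdots s_{i-1}s_is_{i-1}\cdots s_1$. Each reflection is exactly one of the $t_i$. The reflection order is $t_1<_{\mathsf c}\cdots<_{\mathsf c}t_N$, and $\mathsf R(\mathsf c)=\mathsf t_1\cdots\mathsf t_N$. $m$-factorizations. A colored reflection $r^{(i)}$ ($r\in\mathcal R$, $0\le i\le m$) stands for the letter $r$ in the $(i+1)$-st copy of $\mathsf R(\mathsf c)$ in $\mathsf R(\mathsf c)^{m+1}$. Colored reflections are ordered by $\le_{\mathsf c}$, first by color and then by the reflection order (i.e. by position in $\mathsf R(\mathsf c)^{m+1}$). An $m$-factorization of $\mathsf c$ is a subword of $\mathsf R(\mathsf c)^{m+1}$ that is a reduced $\mathcal R$-word of $c$ (i.e. $|\mathcal S|$ letters with product $c$); it is regarded as a set of colored reflections. Increasing rotation. If $\mathsf w$ is an $m$-factorization containing $r^{(i)}$ with $i<m$, the increasing rotation of $\mathsf w$ at the rotated reflection $r^{(i)}$ is the $m$-factorization obtained by replacing $r^{(i)}$ by $r^{(i+1)}$ and replacing every colored reflection $t^{(j)}$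 of $\mathsf w$ strictly between $r^{(i)}$ and $r^{(i+1)}$ by the unique colored copy of $rtr$ lying strictly between $r^{(i)}$ and $r^{(i+1)}$; all other letters are kept. The $m$-Cambrian lattice $\mathrm{Camb}^{(m)}(W,\mathsf c)$ is the poset on $m$-factorizations whose order is the reflexive transitive closure of increasing rotations; the covers of $\mathsf w$ are exactly its increasing rotations. A $\mathsf c$-increasing chain from $\mathsf w$ to $\mathsf w'$ is a saturated chain $\mathsf w=\mathsf v_0\lessdot\cdots\lessdot\mathsf v_k=\mathsf w'$ ($k\ge0$) of increasing rotations whose successive rotated (colored) reflections are increasing for $<_{\mathsf c}$. *)

(* Defs.v *)
From mathcomp Require Import all_boot all_order all_fingroup.

Set Implicit Arguments.
Unset Strict Implicit.
Unset Printing Implicit Defensive.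

Import Order.TTheory GroupScope.

(* The type gT is the whole group W.  The last clause says that W is presented
   by the generators S and the relations (s t)^m(s,t) = 1, where m(s,t) is the
   order of s t, as the universal property among all (possibly infinite)
   groups. *)
Definition coxeter_system (gT : finGroupType) (S : {set gT}) : Prop :=
  [/\ <<S>> = [set: gT],
      (forall s, s \in S -> #[s] = 2)
    & forall (hT : groupType) (f : gT -> hT),
        (forall s t, s \in S -> t \in S -> (f s * f t) ^+ #[s * t] = 1) ->
        exists2 g : gT -> hT, {morph g : x y / x * y} & {in S, g =1 f}].

Definition coxeter_word (gT : finGroupType) (S : {set gT}) (c : seq gT) : Prop :=
  uniq c /\ c =i S.

Definition reduced_word (gT : finGroupType) (A : {set gT}) (x : gT)
    (u : seq gT) : Prop :=
  [/\ all [in A] u,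
      \prod_(a <- u) a = x
    & forall u' : seq gT,
        all [in A] u' -> \prod_(a <- u') a = x -> size u <= size u'].

Definition longest_element (gT : finGroupType) (S : {set gT}) (w0 : gT) : Prop :=
  forall (x : gT) (u u0 : seq gT),
    reduced_word S x u -> reduced_word S w0 u0 -> size u <= size u0.

(* The letter in position p (counted from 0) of the infinite word c c c ... *)
Definition cyclic_letter (gT : finGroupType) (c : seq gT) (p : nat) : gT :=
  nth 1 c (p %% size c).

(* A subword of c c c ... is given by its increasing sequence of positions;
   leftmost means that this sequence is lexicographically smallest. *)
Definition sorting_word (gT : finGroupType) (S : {set gT}) (c : seq gT) (x : gT)
    (u : seq gT) : Prop :=
  exists ps : seq nat,
    [/\ sorted ltn ps,
        u = map (cyclic_letter c) ps,
        reduced_word S x u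
      & forall qs : seq nat,
          sorted ltn qs -> reduced_word S x (map (cyclic_letter c) qs) ->
          ((ps : seqlexi nat) <= qs)%O].

(* R(c), where u is the c-sorting word of the longest element. *)
Definition reflection_order (gT : finGroupType) (u : seq gT) : seq gT :=
  [seq \prod_(a <- take i u) a * nth 1 u i * \prod_(a <- rev (take i u)) a
     | i <- iota 0 (size u)].

Definition colored (gT : finGroupType) (m : nat) : finType :=
  (gT * 'I_m.+1)%type.

(* The letters of R(c)^(m+1), that is, all colored reflections, in order. *)
Definition colored_letters (gT : finGroupType) (m : nat) (R : seq gT) :
    seq (colored gT m) :=
  [seq (r, i) | i <- enum 'I_m.+1, r <- R].

Definition ltc (gT : finGroupType) (m : nat) (R : seq gT) :
    rel (colored gT m) :=
  fun x y => (x.2 < y.2) || (x.2 == y.2) && (index x.1 R < index y.1 R).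

(* Reduced words of c in the reflections are the words with #|S| letters and
   product c. *)
Definition is_mfactorization (gT : finGroupType) (m : nat) (S : {set gT})
    (c R : seq gT) : pred {set colored gT m} :=
  fun w =>
    [&& w \subset colored_letters m R, #|w| == #|S|
      & \prod_(x <- colored_letters m R | x \in w) x.1 == \prod_(s <- c) s].

Definition mfactorization (gT : finGroupType) (m : nat) (S : {set gT})
    (c R : seq gT) : Type :=
  {w : {set colored gT m} | is_mfactorization S c R w}.

(* r^(i) |-> r^(i+1); only meaningful for i < m. *)
Definition next_color (gT : finGroupType) (m : nat) (r : colored gT m) :
    colored gT m :=
  (r.1, inord r.2.+1).

Definition between (gT : finGroupType) (m : nat) (R : seq gT)
    (r x : colored gT m) : bool :=
  ltc R r x && ltc R x (next_color r).

(* A letter x strictly between r^(i) and r^(i+1) is in the rotated set iff it is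
   a colored copy of r t r for some letter t of w in the same range; each
   reflection other than r has exactly one colored copy in that range. *)
Definition rotate_set (gT : finGroupType) (m : nat) (R : seq gT)
    (w : {set colored gT m}) (r : colored gT m) : {set colored gT m} :=
  next_color r
    |: [set x in w | (x != r) && ~~ between R r x]
   :|: [set x in colored_letters m R | between R r x &
          [exists t in w, between R r t && (x.1 == r.1 * t.1 * r.1)]].

(* The increasing rotation of w at r, as an m-factorization; None when r is not
   in w or has color m.  In the other cases the rotated set is known to be again
   an m-factorization, so insub does not add a case where the rotation is
   undefined. *)
Definition increasing_rotation (gT : finGroupType) (m : nat) (S : {set gT})
    (c R : seq gT) (w : @mfactorization gT m S c R) (r : colored gT m) :
    option (@mfactorization gT m S c R) :=
  if (r \in val w) && (r.2 < m) then insub (rotate_set R (val w) r) else None.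

Definition camb_le (gT : finGroupType) (m : nat) (S : {set gT})
    (c R : seq gT) : rel (@mfactorization gT m S c R) :=
  connect (fun u v => [exists r, increasing_rotation u r == Some v]).

Definition camb_cover (gT : finGroupType) (m : nat) (S : {set gT})
    (c R : seq gT) : rel (@mfactorization gT m S c R) :=
  fun u v =>
    [&& u != v, camb_le u v
      & [forall x, camb_le u x && camb_le x v ==> (x == u) || (x == v)]].

(* u :: vs is a saturated chain of increasing rotations, at the successive
   colored reflections rs. *)
Fixpoint rotation_chain (gT : finGroupType) (m : nat) (S : {set gT})
    (c R : seq gT) (u : @mfactorization gT m S c R) (rs : seq (colored gT m))
    (vs : seq (@mfactorization gT m S c R)) : bool :=
  match rs, vs with
  | [::], [::] => true
  | r :: rs', v :: vs' =>
      [&& camb_cover u v, increasing_rotation u r == Some v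
        & rotation_chain v rs' vs']
  | _, _ => false
  end.

Definition increasing_chain (gT : finGroupType) (m : nat) (S : {set gT})
    (c R : seq gT) (w w' : @mfactorization gT m S c R)
    (vs : seq (@mfactorization gT m S c R)) : Prop :=
  exists rs us,
    [/\ vs = w :: us, last w us = w', rotation_chain w rs us
      & sorted (ltc R) rs].

Definition next_step (gT : finGroupType) (m : nat) (S : {set gT})
    (c R : seq gT) (w' u : @mfactorization gT m S c R) (r : colored gT m) :
    option (@mfactorization gT m S c R) :=
  if (r \notin val u :\: val w') && (r \notin val w' :\: val u) then Some u
  else if (r \in val u :\: val w') && (r.2 < m) then increasing_rotation u r
  else None.

(* The sequence u, next_step w' u r_0, ... along rs = r_0, r_1, ..., or None
   if the computation aborts. *)
Fixpoint computation_along (gT : finGroupType) (m : nat) (S : {set gT})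
    (c R : seq gT) (w' u : @mfactorization gT m S c R)
    (rs : seq (colored gT m)) : option (seq (@mfactorization gT m S c R)) :=
  if rs is r :: rs' then
    if next_step w' u r is Some v then
      omap (cons u) (computation_along w' v rs')
    else None
  else Some [:: u].

Definition computation (gT : finGroupType) (m : nat) (S : {set gT})
    (c R : seq gT) (w w' : @mfactorization gT m S c R) :
    option (seq (@mfactorization gT m S c R)) :=
  computation_along w' w (colored_letters m R).

(* Main.v *)
(** Rotating at r only changes letters between r and its next copy, and it
removes r.  Hence, along an increasing chain, the status of a letter is settled
once the chain has passed it, so the chain is determined greedily by the
comparison with w', and conversely a computation that does not abort ends at w'.
That rotations are covers follows from the extreme letters: in a sequence of
rotations, the smallest rotated letter disappears for good, and the next copy of
the largest one is new (a cardinality count shows that a factorization which can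
be rotated at q does not contain the next copy of q).  If the sequence has the
same effect as one rotation at r, all its rotated letters must equal r. *)
Require Import Defs.
From mathcomp Require Import all_boot all_order all_fingroup.
From mathcomp Require Import zify.

Set Implicit Arguments.
Unset Strict Implicit.
Unset Printing Implicit Defensive.

Import GroupScope.

(** * Distinctness of the letters of R(c) *)

Lemma prodg_rev_invol (gT : finGroupType) (s : seq gT) :
  all (fun a => a * a == 1) s -> \prod_(a <- rev s) a = (\prod_(a <- s) a)^-1.
Proof.
elim: s => [|a s IHs] /=; first by rewrite !big_nil invg1.
case/andP=> /eqP aa /IHs eqs.
rewrite rev_cons -cats1 big_cat /= big_seq1 big_cons eqs invMg.
by congr (_ * _); apply/esym/eqP; rewrite eq_invg_mul aa.
Qed.

(** If two of these reflections coincided, the two corresponding letters could be deleted from [u]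
    without changing its product, against the minimality of its length. *)
Lemma uniq_reflection_order (gT : finGroupType) (S : {set gT}) (x : gT)
    (u : seq gT) :
  (forall s, s \in S -> s * s = 1) -> reduced_word S x u ->
  uniq (reflection_order u).
Proof.
move=> invS [uS ux umin].
have inv2 (s : seq gT) : all [in S] s -> all (fun a => a * a == 1) s.
  by apply: sub_all => a aS; rewrite invS.
have takeS i : all [in S] (take i u).
  by apply/allP=> a /mem_take; apply: (allP uS).
pose t i := \prod_(a <- take i u) a * nth 1 u i * (\prod_(a <- take i u) a)^-1.
have tneq i j : i < j -> j < size u -> t i <> t j.
  move=> lt_ij lt_ju.
  have lt_iu : i < size u by apply: ltn_trans lt_ju.
  set A := take i u; set a := nth 1 u i; set b := nth 1 u j.
  pose B := drop i.+1 (take j u); pose C := drop j.+1 u.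
  have eqj : take j u = A ++ a :: B.
    rewrite -(cat_take_drop i (take j u)) -take_min (minn_idPl (ltnW lt_ij)).
    rewrite (drop_nth 1) ?size_take ?lt_ju // nth_take //.
  have equ : u = (A ++ a :: B) ++ b :: C.
    by rewrite -eqj -{1}(cat_take_drop j u) (drop_nth 1 lt_ju).
  rewrite /t eqj -/A -/a -/b !big_cat /= !big_cons => eq_t.
  have aBb : a * \prod_(z <- B) z * b = \prod_(z <- B) z.
    move: eq_t; set PA := \prod_(z <- A) z; set PB := \prod_(z <- B) z.
    rewrite !invMg => eq_t.
    have /(congr1 (fun z => PA^-1 * z * PA * a * PB)) := eq_t.
    rewrite !mulgA !mulVg !mul1g !mulgKV => <-.
    have -> : a * a = 1 by apply: invS; apply: (allP uS); exact: mem_nth.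
    by rewrite mul1g.
  have : size u <= size (A ++ B ++ C).
    apply: umin.
      by move: uS; rewrite equ !all_cat /= =>
        /andP[/and3P[-> _ ->] /andP[_ ->]].
    rewrite -ux equ !big_cat /= !big_cons -[in LHS]aBb.
    by rewrite !mulgA.
  by rewrite {1}equ !size_cat /=; lia.
rewrite /reflection_order map_inj_in_uniq ?iota_uniq // => i j.
rewrite !mem_iota !add0n /= => ltiu ltju.
rewrite !prodg_rev_invol ?inv2 // -/(t i) -/(t j) => eq_t.
case: (ltngtP i j) => // [ltij | ltji].
  by case: (tneq i j).
by case: (tneq j i).
Qed.

(** * The order on colored reflections *)

Section Ltc.
Variables (gT : finGroupType) (m : nat) (R : seq gT).
Implicit Types x y q r : colored gT m.

Lemma ltc_irr x : ltc R x x = false.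
Proof. by rewrite /ltc eqxx !ltnn. Qed.

Lemma ltc_trans : transitive (@ltc gT m R).
Proof. by move=> y x z; rewrite /ltc -!val_eqE /=; lia. Qed.

Lemma ltc_total x y : x.1 \in R -> [|| ltc R x y, x == y | ltc R y x].
Proof.
case: x y => [a i] [b j]; rewrite /ltc xpair_eqE /= => aR.
rewrite -!val_eqE /=.
have -> : (a == b) = (index a R == index b R).
  apply/eqP/eqP=> [-> // | eq_ab].
  by rewrite -(nth_index 1 aR) eq_ab nth_index // -index_mem -eq_ab index_mem.
by lia.
Qed.

Lemma next_color2 r : r.2 < m -> (next_color r).2 = r.2.+1 :> nat.
Proof. by move=> ltm; rewrite /= inordK. Qed.

Lemma next_color_inj x y :
  x.2 < m -> y.2 < m -> next_color x = next_color y -> x = y.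
Proof.
move=> xm ym eqxy; move: (next_color2 xm) (next_color2 ym); rewrite eqxy => ->.
case: x y eqxy {xm ym} => [a i] [b j] [-> _] [eqij].
by congr (_, _); apply: val_inj.
Qed.

Lemma ltc_next r : r.2 < m -> ltc R r (next_color r).
Proof. by move=> ltm; rewrite /ltc next_color2 // ltnSn. Qed.

Lemma ltc_next_color x y :
  x.2 < m -> y.2 < m -> ltc R (next_color x) (next_color y) = ltc R x y.
Proof.
by move=> xm ym; rewrite /ltc -!val_eqE /= !inordK // eqSS !ltnS.
Qed.

(** In the window between [r] and its next copy the color is forced: that of [r] for reflections
    after [r.1] in [R], the next color for those before. *)
Lemma between_inj r x y :
  r.2 < m -> between R r x -> between R r y -> x.1 = y.1 -> x = y.
Proof.
case: x y => [a i] [b j] ltm; rewrite /between /ltc -!val_eqE /= inordK //.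
move=> bx hy eqab; rewrite -{b}eqab in hy *; congr (_, _); apply: val_inj.
by move: bx hy => /=; lia.
Qed.

Lemma mem_colored_letters x : (x \in colored_letters m R) = (x.1 \in R).
Proof.
apply/allpairsP/idP => [[[i r] [/= _ rR ->]] // | xR].
by exists (x.2, x.1); rewrite mem_enum; case: x xR.
Qed.

Lemma sorted_colored_letters : uniq R -> sorted (ltc R) (colored_letters m R).
Proof.
move=> uR; rewrite sorted_pairwise; last exact: ltc_trans.
have: pairwise (fun i j : 'I_m.+1 => i < j) (enum 'I_m.+1).
  rewrite -(@pairwise_map _ _ val ltn) val_enum_ord -sorted_pairwise.
    exact: iota_ltn_sorted.
  exact: ltn_trans.
rewrite /colored_letters; elim: (enum _) => [|i s IHs] //= /andP[is_ ss].
rewrite pairwise_cat IHs // andbT; apply/andP; split.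
  apply/allrelP=> _ _ /mapP[a _ ->] /allpairsP[[j b] [/= js _ ->]].
  by rewrite /ltc /= (allP is_).
rewrite pairwise_map; apply/(pairwiseP 1) => k l kR lR ltkl.
by rewrite /ltc /= eqxx !index_uniq // ltkl orbT.
Qed.

(** * The effect of one rotation *)

Section RotateSet.
Variables (w : {set colored gT m}) (r : colored gT m).
Hypothesis ltm : r.2 < m.

Lemma rotate_set_low x : ltc R x r -> (x \in rotate_set R w r) = (x \in w).
Proof.
move=> ltxr; rewrite !inE /between.
have -> : x == next_color r = false.
  by apply/eqP=> eqx; rewrite eqx in ltxr;
     have := ltc_trans ltxr (ltc_next ltm); rewrite ltc_irr.
have -> : x == r = false by apply/eqP=> eqx; rewrite eqx ltc_irr in ltxr.
have -> : ltc R r x = false.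
  by apply/negP=> /(ltc_trans ltxr); rewrite ltc_irr.
by rewrite /= !andbF andbT orbF.
Qed.

Lemma rotate_set_high x :
  ltc R (next_color r) x -> (x \in rotate_set R w r) = (x \in w).
Proof.
move=> ltx; rewrite !inE /between.
have -> : x == next_color r = false.
  by apply/eqP=> eqx; rewrite eqx ltc_irr in ltx.
have -> : x == r = false.
  apply/eqP=> eqx; rewrite eqx in ltx.
  by have := ltc_trans ltx (ltc_next ltm); rewrite ltc_irr.
have -> : ltc R x (next_color r) = false.
  by apply/negP=> /(ltc_trans ltx); rewrite ltc_irr.
by rewrite /= !andbF /= !andbT orbF.
Qed.

Lemma rotate_set_self : r \notin rotate_set R w r.
Proof.
rewrite !inE /between ltc_irr eqxx /= !andbF !orbF.
by apply/eqP=> eqr; have := ltc_next ltm; rewrite -eqr ltc_irr.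
Qed.

Lemma next_rotate_set : next_color r \in rotate_set R w r.
Proof. by rewrite !inE eqxx. Qed.

(** [r] and its next copy merge into one letter, while conjugation by [r] cannot increase the number
    of letters in between. *)
Lemma card_rotate_set :
  r \in w -> next_color r \in w -> #|rotate_set R w r| < #|w|.
Proof.
move=> rw nrw; pose T := [set x in w | between R r x].
pose C := [set x in colored_letters m R | between R r x &
  [exists t in w, between R r t && (x.1 == r.1 * t.1 * r.1)]].
pose K := [set x in w | (x != r) && ~~ between R r x].
have nrr : next_color r != r.
  by apply/eqP=> eqr; have := ltc_next ltm; rewrite eqr ltc_irr.
have -> : rotate_set R w r = K :|: C.
  rewrite /rotate_set -/C -/K; congr (_ :|: _); apply/setUidPr.
  by rewrite sub1set inE nrw nrr /between ltc_irr andbF.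
(* By [between_inj] a letter of [C] is determined by its reflection, so it suffices to count
   reflections. *)
have CT : #|C| <= #|T|.
  have leCT : [set x.1 | x in C] \subset [set r.1 * t.1 * r.1 | t in T].
    apply/subsetP=> _ /imsetP[x xC ->]; move: xC; rewrite inE.
    case/and3P=> _ _ /existsP[t /and3P[tw bt /eqP->]].
    by apply/imsetP; exists t; rewrite ?inE ?tw.
  rewrite -(card_in_imset (f := fun x : colored gT m => x.1) (D := mem C)).
    by apply: leq_trans (subset_leq_card leCT) (leq_imset_card _ _).
  move=> x y; rewrite !inE => /and3P[_ bx _] /and3P[_ hy _].
  exact: between_inj ltm bx hy.
apply: leq_ltn_trans (leq_card_setU K C) _.
(* [w] splits into [K], [T] and the single letter [r], which makes the inequality strict. *)
have -> : #|w| = (#|K| + #|T|).+1.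
  rewrite -(cardsID T w) (setIidPr _); last first.
    by apply/subsetP=> x; rewrite inE => /andP[].
  rewrite (cardsD1 r (w :\: T)) !inE rw /between ltc_irr /= addnS addnC.
  congr (_ + _).+1; apply: eq_card => x; rewrite !inE.
  by case: (x \in w); rewrite /= ?andbT ?andbF.
by rewrite ltnS leq_add2l.
Qed.

End RotateSet.
End Ltc.

(** * Sequences of rotations, and rotations as covers *)

Section Rotations.
Variables (gT : finGroupType) (m : nat) (S : {set gT}) (c R : seq gT).
Implicit Types u v w : @mfactorization gT m S c R.
Implicit Types q r x : colored gT m.

Lemma mem_mfactorization u x : x \in val u -> x.1 \in R.
Proof.
by move=> xu; case/and3P: (valP u) => /subsetP/(_ x xu);
   rewrite mem_colored_letters.
Qed.

Lemma increasing_rotationP u v r :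
  increasing_rotation u r = Some v ->
  [/\ r \in val u, r.2 < m & val v = rotate_set R (val u) r].
Proof.
by rewrite /increasing_rotation; case: andP => // -[ru ltm];
   case: insubP => // w _ <- [<-].
Qed.

Lemma rotation_next u v r :
  increasing_rotation u r = Some v -> next_color r \notin val u.
Proof.
case/increasing_rotationP=> ru ltm eqv; apply/negP=> nru.
have := card_rotate_set R ltm ru nru; rewrite -eqv.
by case/and3P: (valP u) => _ /eqP-> _; case/and3P: (valP v) => _ /eqP-> _;
   rewrite ltnn.
Qed.

(** The cover condition of [rotation_chain] is dropped, because that rotations are covers is itself
    derived from these sequences. *)
Fixpoint rotations u (rs : seq (colored gT m))
    (vs : seq (@mfactorization gT m S c R)) : bool :=
  match rs, vs with
  | [::], [::] => true
  | r :: rs', v :: vs' =>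
      (increasing_rotation u r == Some v) && rotations v rs' vs'
  | _, _ => false
  end.

Lemma rotation_chain_rotations u rs vs :
  rotation_chain u rs vs -> rotations u rs vs.
Proof.
by elim: rs u vs => [|r rs IHrs] u [|v vs] //= /and3P[_ -> /IHrs].
Qed.

Lemma rotations_low x u rs vs v :
  rotations u rs vs -> all (ltc R x) rs -> v \in u :: vs ->
  (x \in val v) = (x \in val u).
Proof.
elim: rs u vs => [|r rs IHrs] u [|w vs] //=.
  by rewrite inE => _ _ /eqP->.
case/andP=> /eqP rot_w rots /andP[ltxr lexrs].
rewrite inE => /predU1P[-> // | /(IHrs _ _ rots lexrs) ->].
by case/increasing_rotationP: rot_w => _ ltm ->; rewrite rotate_set_low.
Qed.

(** [next_color] preserves the order, so the next copy of [q] lies above the window of every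
    rotation at a letter below [q]. *)
Lemma rotations_high q u rs vs :
  rotations u rs vs -> q.2 < m -> all (fun r => ltc R r q) rs ->
  (next_color q \in val (last u vs)) = (next_color q \in val u).
Proof.
move=> + qm; elim: rs u vs => [|r rs IHrs] u [|w vs] //=.
case/andP=> /eqP rot_w rots /andP[ltrq lers].
rewrite (IHrs _ _ rots lers).
by case/increasing_rotationP: rot_w => _ ltm ->;
   rewrite rotate_set_high ?ltc_next_color.
Qed.

(** The witness is the smallest rotated letter: rotations at larger letters neither create nor
    remove it. *)
Lemma least_rotation u rs vs :
  rotations u rs vs -> rs != [::] ->
  exists p, [/\ p \in val u, p \notin val (last u vs)
              & all (fun r => (p == r) || ltc R p r) rs].
Proof.
elim: rs u vs => [|r rs IHrs] u [|v vs] //= /andP[/eqP rot_v rots] _.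
have [ru ltm eqv] := increasing_rotationP rot_v.
have rv : r \notin val v by rewrite eqv rotate_set_self.
have small : all (ltc R r) rs -> exists p, [/\ p \in val u,
    p \notin val (last v vs) & all (fun q => (p == q) || ltc R p q) (r :: rs)].
  move=> lers; exists r; split=> //=; last first.
    by rewrite eqxx; apply: sub_all lers => q ->; rewrite orbT.
  by rewrite (rotations_low rots lers) ?mem_last.
case: (eqVneq rs [::]) => [rs0 | rs_nz]; first by apply: small; rewrite rs0.
have [p [pv plast lep]] := IHrs _ _ rots rs_nz.
case/or3P: (ltc_total p (mem_mfactorization ru)) => [ltrp | /eqP eqrp | ltpr].
- apply: small; apply: sub_all lep => q /predU1P[<- //|].
  exact: ltc_trans.
(* The minimum [p] of the tail belongs to [v], from which [r] has just been removed, so the two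
   differ. *)
- by rewrite eqrp pv in rv.
- exists p; split=> //=; last by rewrite ltpr orbT.
  by rewrite eqv rotate_set_low in pv.
Qed.

(** Dual of [least_rotation]: rotations at letters below the largest one leave its next copy
    untouched, and [rotation_next] shows that this copy was absent before. *)
Lemma greatest_rotation u rs vs :
  rotations u rs vs -> rs != [::] ->
  exists q, [/\ q.2 < m, next_color q \notin val u,
                next_color q \in val (last u vs)
              & all (fun r => (r == q) || ltc R r q) rs].
Proof.
elim: rs u vs => [|r rs IHrs] u [|v vs] //= /andP[/eqP rot_v rots] _.
have [ru ltm eqv] := increasing_rotationP rot_v.
have nrv : next_color r \in val v by rewrite eqv next_rotate_set.
have large : all (fun q => ltc R q r) rs -> exists q, [/\ q.2 < m,
    next_color q \notin val u, next_color q \in val (last v vs)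
    & all (fun s => (s == q) || ltc R s q) (r :: rs)].
  move=> lers; exists r; split=> //=; first exact: rotation_next rot_v.
    by rewrite (rotations_high rots ltm lers).
  by rewrite eqxx; apply: sub_all lers => q ->; rewrite orbT.
case: (eqVneq rs [::]) => [rs0 | rs_nz]; first by apply: large; rewrite rs0.
have [q [qm nqv qlast leq]] := IHrs _ _ rots rs_nz.
case/or3P: (ltc_total q (mem_mfactorization ru)) => [ltrq | /eqP eqrq | ltqr].
- exists q; split=> //=; last by rewrite ltrq orbT.
  by rewrite eqv rotate_set_high ?ltc_next_color in nqv.
- by rewrite -eqrq nrv in nqv.
- apply: large; apply: sub_all leq => s /predU1P[-> //|lt_sq].
  exact: ltc_trans ltqr.
Qed.

(** A rotation at [r] changes no letter below [r] and none above its next copy. This squeezes all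
    rotated letters of the sequence to [r], and [r] cannot be rotated twice in a row. *)
Lemma rotations_single u v r rs vs :
  increasing_rotation u r = Some v -> rotations u rs vs -> last u vs = v ->
  size vs <= 1.
Proof.
move=> rot_v rots lastv; have [ru ltm eqv] := increasing_rotationP rot_v.
have [rs0 | rs_nz] := eqVneq rs [::].
  by move: rots; rewrite rs0; case: vs {lastv}.
have [p [pu pv lep]] := least_rotation rots rs_nz.
have [q [qm nqu nqv leq]] := greatest_rotation rots rs_nz.
rewrite lastv in pv nqv.
have lerp : (r == p) || ltc R r p.
  case/or3P: (ltc_total p (mem_mfactorization ru)) => [->|->|ltpr] //.
    exact: orbT.
  by rewrite eqv rotate_set_low ?pu in pv.
have leqr : (q == r) || ltc R q r.
  (* The next copy of [q] carries the same reflection as [q], which gives the membership in [R] that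
     totality asks for. *)
  have nqR := mem_mfactorization nqv.
  have /= := ltc_total r (nqR : q.1 \in R).
  case/or3P=> [->|->|ltrq] //; first exact: orbT.
  by rewrite eqv rotate_set_high ?(negPf nqu) ?ltc_next_color in nqv.
have eqr s : s \in rs -> s = r.
  move=> srs; have := allP lep s srs; have := allP leq s srs => /= lesq leps.
  have lesr : (s == r) || ltc R s r.
    case/predU1P: lesq => [-> // | ltsq]; apply/orP; right.
    by case/predU1P: leqr => [<- // | /(ltc_trans ltsq)].
  have lers : (r == s) || ltc R r s.
    case/predU1P: lerp => [-> // | ltrp]; apply/orP; right.
    by case/predU1P: leps => [<- // | /(ltc_trans ltrp)].
  case/predU1P: lesr => // ltsr; case/predU1P: lers => // ltrs.
  by have := ltc_trans ltsr ltrs; rewrite ltc_irr.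
case: rs vs rots eqr {lastv rs_nz lep leq} => [|s [|s' rs]] [|v1 [|v2 vs]] //=.
  by rewrite andbF.
move=> /and3P[/eqP rot1 /eqP rot2 _] eqr.
have [_ _ eqv1] := increasing_rotationP rot1.
have [sv1 _ _] := increasing_rotationP rot2.
have eqs : s = r by apply: eqr; rewrite mem_head.
have eqs' : s' = r by apply: eqr; rewrite !inE eqxx orbT.
have := rotate_set_self R (val u) ltm.
by rewrite -[X in X \notin _]eqs' -[X in rotate_set _ _ X]eqs -eqv1 sv1.
Qed.

(** An element [x] of the interval cuts a sequence of rotations from [u] to [v] in two. By
    [rotations_single] there is at most one step, so one of the two pieces is empty. *)
Lemma increasing_rotation_cover u v r :
  increasing_rotation u r = Some v -> camb_cover u v.
Proof.
move=> rot_v; have [ru ltm eqv] := increasing_rotationP rot_v.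
apply/and3P; split.
- apply/eqP=> equv; have := rotate_set_self R (val u) ltm.
  by rewrite -eqv -equv ru.
- by apply: connect1; apply/existsP; exists r; rewrite rot_v.
apply/forallP=> x.
apply/implyP=> /andP[/connectP[p1 pth1 eqx] /connectP[p2 pth2 eqv2]].
have [rs rots] : exists rs, rotations u rs (p1 ++ p2).
  have : path (fun u v => [exists r, increasing_rotation u r == Some v])
           u (p1 ++ p2) by rewrite cat_path pth1 -eqx.
  elim: (p1 ++ p2) (u) => [|y p IHp] z /=; first by exists [::].
  case/andP=> /existsP[s rot_s] /IHp[rs rots].
  by exists (s :: rs) => /=; rewrite rot_s.
have lastv : last u (p1 ++ p2) = v by rewrite last_cat -eqx -eqv2.
have := rotations_single rot_v rots lastv; rewrite size_cat => size_p.
case: p1 p2 eqx eqv2 {pth1 pth2 rots lastv} size_p => [|y p1] [|z p2] //= -> ->;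
  rewrite ?eqxx ?orbT //; lia.
Qed.

(** * Comparison of the computation with increasing chains *)

(** Induction on the unread letters [l]; the invariant is that the rest of the chain rotates only at
    letters of [l]. *)
Lemma computation_along_chain w' u l rs vs :
  sorted (ltc R) l -> rotations u rs vs -> sorted (ltc R) rs ->
  {subset rs <= l} -> last u vs = w' ->
  exists ws, [/\ computation_along w' u l = Some ws, last u ws = w'
               & undup ws = u :: vs].
Proof.
elim: l u rs vs => [|r l IHl] u rs vs /=.
  move=> _ rots _ rsub lastv; exists [:: u].
  case: rs rots rsub => [|s rs] rots rsub; last first.
    by have := rsub s (mem_head _ _).
  by case: vs rots lastv.
move=> pl rots srs rsub lastv.
have ltl := order_path_min (@ltc_trans _ _ R) pl; have sl := path_sorted pl.
have [rrs | rNrs] := boolP (r \in rs); last first.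
  have rsub' : {subset rs <= l}.
    move=> s srs'; have := rsub s srs'; rewrite inE => /predU1P[eqs|//].
    by rewrite -eqs srs' in rNrs.
  (* All remaining rotations are above [r], so [u] and [w'] agree at [r] and the computation stands
     still. *)
  have ltrs : all (ltc R r) rs by apply/allP=> s /rsub' /(allP ltl).
  have [ws [comp lastw undw]] := IHl _ _ _ sl rots srs rsub' lastv.
  exists (u :: ws); rewrite /next_step !inE -lastv.
  rewrite (rotations_low rots ltrs) ?mem_last // andNb lastv /= comp.
  (* [undup] keeps the last occurrence of an entry, so the repeated [u] in front disappears. *)
  by rewrite lastw -mem_undup undw mem_head.
case: rs vs rots srs rsub rrs lastv => [|s rs] [|v vs] //=.
case/andP=> /eqP rot_v rots pss rsub rin lastv.
have lts := order_path_min (@ltc_trans _ _ R) pss.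
have eqsr : s = r.
  have := rsub s (mem_head _ _); rewrite inE => /predU1P[// | /(allP ltl) ltrs].
  move: rin; rewrite inE => /predU1P[// | /(allP lts) ltsr].
  by have := ltc_trans ltrs ltsr; rewrite ltc_irr.
rewrite {s}eqsr in rot_v pss rsub lts {rin}.
have rsub' : {subset rs <= l}.
  move=> s srs; have := rsub s; rewrite !inE srs orbT => /(_ isT).
  by case/predU1P=> // eqs; have := allP lts s srs; rewrite eqs /= ltc_irr.
have [ws [comp lastw undw]] := IHl _ _ _ sl rots (path_sorted pss) rsub' lastv.
have [ru ltm eqv] := increasing_rotationP rot_v.
(* The removed [r] never returns. Hence [w'] lacks it, which triggers the rotation, and [u] differs
   from all later members, so [undup] keeps it. *)
have rNv v' : v' \in v :: vs -> r \notin val v'.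
  by move=> v'vs; rewrite (rotations_low rots lts v'vs) eqv rotate_set_self.
have rNw' : r \notin val w' by rewrite -lastv; apply/rNv/mem_last.
exists (u :: ws); rewrite /next_step !inE ru (negPf rNw') ltm /= rot_v comp.
have uNvs : u \notin v :: vs by apply/negP=> /rNv; rewrite ru.
rewrite -mem_undup undw (negPf uNvs); split=> //.
by case: ws lastw undw {comp} => [|x ws] // <-.
Qed.

(** A skipped letter already agrees with [w']; a rotated one is absent from [w'] and leaves. Later
    rotations are at larger letters and preserve this agreement. *)
Lemma chain_of_computation_along w' u l ws :
  sorted (ltc R) l -> computation_along w' u l = Some ws ->
  exists rs vs, [/\ rotation_chain u rs vs, sorted (ltc R) rs, {subset rs <= l}
    & {in l, val (last u vs) =i val w'}].
Proof.
elim: l u ws => [|r l IHl] u ws /= pl; first by exists [::], [::].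
have ltl := order_path_min (@ltc_trans _ _ R) pl; have sl := path_sorted pl.
case step: next_step => [v|] //.
case comp: computation_along => [ws'|] // _.
have [rs [vs [rots srs rsub eqw']]] := IHl _ _ sl comp.
have ltrs : all (ltc R r) rs by apply/allP=> s /rsub/(allP ltl).
have low := rotations_low (rotation_chain_rotations rots) ltrs (mem_last _ _).
move: step; rewrite /next_step; case: ifP => [same [equv] | _].
  exists rs, vs; rewrite equv; split=> // s.
    by move/rsub; rewrite inE orbC => ->.
  rewrite inE => /predU1P[-> | /eqw' //]; rewrite low -equv.
  by move: same; rewrite !inE; do 2!case: (r \in _).
case: ifP => // /andP[rD ltm] rot_v.
exists (r :: rs), (v :: vs); split=> /=.
- by rewrite (increasing_rotation_cover rot_v) rot_v eqxx.
- by rewrite path_min_sorted.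
- by move=> s; rewrite !inE => /predU1P[-> | /rsub ->]; rewrite ?eqxx ?orbT.
move=> s; rewrite inE => /predU1P[-> | /eqw' //]; rewrite low.
have [_ _ ->] := increasing_rotationP rot_v.
by move: rD; rewrite inE (negPf (rotate_set_self R _ ltm)) => /andP[/negPf->].
Qed.

End Rotations.

Theorem proposition4p1 (gT : finGroupType) (S : {set gT}) (c : seq gT) (m : nat)
    (w0 : gT) (u : seq gT)
    (hW : coxeter_system S) (hc : coxeter_word S c) (hm : (1 <= m)%N)
    (hw0 : longest_element S w0) (hu : sorting_word S c w0 u)
    (w w' : @mfactorization gT m S c (reflection_order u)) :
  (forall vs, increasing_chain w w' vs ->
     exists ws, [/\ computation w w' = Some ws, last w ws = w' & undup ws = vs])
  /\
  ((~ exists vs, increasing_chain w w' vs) -> computation w w' = None).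
Proof.
have uR : uniq (reflection_order u).
  have [ps [_ _ redu _]] := hu.
  apply: uniq_reflection_order redu => s sS; have [_ ordS _] := hW.
  by rewrite -[s * s]/(s ^+ 2) -(ordS s sS) expg_order.
have sL := sorted_colored_letters m uR.
split=> [vs [rs [us [-> lastw chain srs]]] | nochain].
  have rots := rotation_chain_rotations chain.
  apply: (computation_along_chain sL rots srs _ lastw).
  elim: rs us w {lastw chain srs} rots => [|r rs IHrs] [|v us] x //=.
  case/andP=> /eqP/increasing_rotationP[rx _ _] /IHrs rsub s.
  rewrite inE => /predU1P[-> | /rsub //].
  by rewrite mem_colored_letters (mem_mfactorization rx).
case comp: computation => [ws|] //; case: nochain.
have [rs [vs [chain srs _ eqw']]] := chain_of_computation_along sL comp.
exists (w :: vs), rs, vs; split=> //; apply/val_inj/setP=> x.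
(* The computation compares only the letters that it reads; an m-factorization contains no
   others. *)
have [xL | xNL] := boolP (x \in colored_letters m (reflection_order u)).
  exact: eqw'.
have notin (z : @mfactorization gT m S c (reflection_order u)) : x \notin val z.
  by apply: contra xNL => /mem_mfactorization; rewrite mem_colored_letters.
by rewrite !(negPf (notin _)).
Qed.
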